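(* Let $\Omega\subseteq\mathbb{H}$ be a non-empty circular domain and let $f\in\mathcal{SR}(\Omega)$. Then $$(\exp_*(f))^s=\exp_*(2f_0),$$ $$\frac{\exp_*(f)+\exp_*(f^c)}{2}=\exp_*(f_0)\,\mu(f),$$ $$\frac{\exp_*(f)-\exp_*(f^c)}{2}=\exp_*(f_0)\,\nu(f)\,f_v,$$ $$\exp_*(f)*\exp_*(-f)\equiv1.$$ In particular $\exp_*(f)$ is a never-vanishing function.
   Context: $\mathbb{H}$ is the algebra of quaternions (with the Euclidean topology of $\mathbb{R}^4$), with conjugation $q\mapsto q^c$, and $\mathbb{S}=\{q\in\mathbb{H}: q^2=-1\}$. For $D\subseteq\mathbb{C}=\{\alpha+\imath\beta:\alpha,\beta\in\mathbb{R}\}$ invariant under complex conjugation, $\Omega_D=\{\alpha+\beta I:\alpha+\imath\beta\in D,\ I\in\mathbb{S}\}$; sets of this form are called circular, and a circular domain is a connected open circular subset of $\mathbb{H}$. A stem function is $F=F_1+\imath F_2:D\to\mathbb{H}\otimes_{\mathbb{R}}\mathbb{C}$ ($F_1,F_2$ $\mathbb{H}$-valued) with $F(\overline z)=\overline{F(z)}$, where $\overline{p+\imath q}=p-\imath q$. It induces the slice function $f=\mathcal{I}(F):\Omega_D\to\mathbb{H}$, $f(\alpha+\beta I)=F_1(\alpha+\imath\beta)+I F_2(\alpha+\imath\beta)$. On a circular domain $\Omega=\Omega_D$, $f=\mathcal I(F)$ is slice-regular if $F$ is holomorphic for the natural complex structures of $\mathbb{C}$ and $\mathbb{H}\otimes_{\mathbb{R}}\mathbb{C}$;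 $\mathcal{SR}(\Omega)$ is the set of slice-regular functions, and $f$ is slice-preserving if $F_1,F_2$ are real-valued. The $*$-product is $\mathcal I(F)*\mathcal I(G)=\mathcal I(FG)$, with $(p+\imath q)(p'+\imath q')=pp'-qq'+\imath(pq'+qp')$; if one factor is slice-preserving it is the pointwise product. For $f=\mathcal I(F_1+\imath F_2)\in\mathcal{SR}(\Omega)$: $f^c=\mathcal I(F_1^c+\imath F_2^c)$, $f_0=\frac{f+f^c}{2}$, $f_v=\frac{f-f^c}{2}$, $f^s=f*f^c$, and $f_v^s$ means $(f_v)^s$; the functions $f_0$ and $f_v^s$ are slice-preserving. The $*$-exponential is $\exp_*(f)=\sum_{n\in\mathbb{N}}\frac{f^{*n}}{n!}$ ($f^{*n}$ the $n$-th $*$-power, $f^{*0}=1$), which converges uniformly on compact subsets of $\Omega$ to an element of $\mathcal{SR}(\Omega)$. Moreover $$\mu(f)=\sum_{m\in\mathbb{N}}\frac{(-1)^m(f_v^s)^m}{(2m)!},\qquad \nu(f)=\sum_{m\in\mathbb{N}}\frac{(-1)^m(f_v^s)^m}{(2m+1)!},$$ which are slice-preserving regular functions on $\Omega$. *)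

(* Defs.v *)
From HB Require Import structures.
From mathcomp Require Import all_boot all_order all_algebra.
From mathcomp Require Import complex.
From mathcomp Require Import all_classical all_reals all_analysis.
From mathcomp Require Import ring.

Set Implicit Arguments.
Unset Strict Implicit.
Unset Printing Implicit Defensive.
Import Order.TTheory GRing.Theory Num.Theory.
Import numFieldNormedType.Exports.
Local Open Scope classical_set_scope.
Local Open Scope ring_scope.

(* Real quaternions [a + b i + c j + d k], carried by row vectors so that the
   topology is that of R^4. *)
Definition quat (R : Type) := 'rV[R]_4.

HB.instance Definition _ (R : realType) :=
  NormedModule.copy (quat R) 'rV[R]_4.
HB.instance Definition _ (R : realType) :=
  Uniform_isComplete.Build (quat R) (@cauchy_cvg 'rV[R]_4).

Definition mkquat (R : Type) (a b c d : R) : quat R :=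
  \row_(i < 4) nth a [:: a; b; c; d] i.

Section QuaternionRing.
Variable R : realType.
Implicit Types p q r : quat R.

Definition q0 (q : quat R) : R := q ord0 0.
Definition q1 (q : quat R) : R := q ord0 1.
Definition q2 (q : quat R) : R := q ord0 2.
Definition q3 (q : quat R) : R := q ord0 3.

Lemma quatP p q :
  q0 p = q0 q -> q1 p = q1 q -> q2 p = q2 q -> q3 p = q3 q -> p = q.
Proof.
move=> h0 h1 h2 h3; apply/rowP => -[[|[|[|[|//]]]] h].
- by have -> : Ordinal h = 0 by apply/val_inj.
- by have -> : Ordinal h = 1 by apply/val_inj.
- by have -> : Ordinal h = 2 by apply/val_inj.
- by have -> : Ordinal h = 3 by apply/val_inj.
Qed.

Lemma mkquatE a b c d : (q0 (mkquat a b c d) = a) * (q1 (mkquat a b c d) = b) *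
  (q2 (mkquat a b c d) = c) * (q3 (mkquat a b c d) = d).
Proof. by rewrite /q0 /q1 /q2 /q3 !mxE. Qed.

Lemma quatDE p q : (q0 (p + q) = q0 p + q0 q) * (q1 (p + q) = q1 p + q1 q) *
  (q2 (p + q) = q2 p + q2 q) * (q3 (p + q) = q3 p + q3 q).
Proof. by rewrite /q0 /q1 /q2 /q3 !mxE. Qed.

Lemma quatZE k p : (q0 (k *: p) = k * q0 p) * (q1 (k *: p) = k * q1 p) *
  (q2 (k *: p) = k * q2 p) * (q3 (k *: p) = k * q3 p).
Proof. by rewrite /q0 /q1 /q2 /q3 !mxE. Qed.

Definition mulq p q : quat R := mkquat
  (q0 p * q0 q - q1 p * q1 q - q2 p * q2 q - q3 p * q3 q)
  (q0 p * q1 q + q1 p * q0 q + q2 p * q3 q - q3 p * q2 q)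
  (q0 p * q2 q - q1 p * q3 q + q2 p * q0 q + q3 p * q1 q)
  (q0 p * q3 q + q1 p * q2 q - q2 p * q1 q + q3 p * q0 q).

Definition oneq : quat R := mkquat 1 0 0 0.

Fact mulqA : associative mulq.
Proof. by move=> p q r; apply: quatP; rewrite !mkquatE; ring. Qed.
Fact mul1q : left_id oneq mulq.
Proof. by move=> p; apply: quatP; rewrite !mkquatE; ring. Qed.
Fact mulq1 : right_id oneq mulq.
Proof. by move=> p; apply: quatP; rewrite !mkquatE; ring. Qed.
Fact mulqDl : left_distributive mulq +%R.
Proof. by move=> p q r; apply: quatP; rewrite !(quatDE, mkquatE); ring. Qed.
Fact mulqDr : right_distributive mulq +%R.
Proof. by move=> p q r; apply: quatP; rewrite !(quatDE, mkquatE); ring. Qed.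
Fact oneq_neq0 : oneq != 0.
Proof.
by apply/eqP => /(congr1 q0); rewrite mkquatE /q0 mxE => /eqP; rewrite oner_eq0.
Qed.

HB.instance Definition _ := GRing.Zmodule_isNzRing.Build (quat R)
  mulqA mul1q mulq1 mulqDl mulqDr oneq_neq0.

Fact scaleqAl k p q : k *: (p * q) = (k *: p) * q.
Proof. by apply: quatP; rewrite !(quatZE, mkquatE); ring. Qed.
HB.instance Definition _ :=
  GRing.LSemiModule_isLSemiAlgebra.Build R (quat R) scaleqAl.

Fact scaleqAr k p q : k *: (p * q) = p * (k *: q).
Proof. by apply: quatP; rewrite !(quatZE, mkquatE); ring. Qed.
HB.instance Definition _ :=
  GRing.LSemiAlgebra_isSemiAlgebra.Build R (quat R) scaleqAr.

Definition conjq q : quat R := mkquat (q0 q) (- q1 q) (- q2 q) (- q3 q).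

End QuaternionRing.

Section SliceFunctions.
Variable R : realType.
Local Notation H := (quat R).

(* H (x)_R C, the pair (p, q) standing for p + i q. *)
Local Notation HC := (H * H)%type.

Definition conjHC (w : HC) : HC := (w.1, - w.2).

Definition mulHC (w w' : HC) : HC :=
  (w.1 * w'.1 - w.2 * w'.2, w.1 * w'.2 + w.2 * w'.1).

Definition scaleHC (c : R[i]) (w : HC) : HC :=
  (complex.Re c *: w.1 - complex.Im c *: w.2,
   complex.Re c *: w.2 + complex.Im c *: w.1).

Definition sphere : set H := [set I | I ^+ 2 = -1].

Definition point (z : R[i]) (I : H) : H := (complex.Re z)%:A + complex.Im z *: I.

Definition conj_invariant (D : set R[i]) := forall z, D z -> D z^*.

Definition circularization (D : set R[i]) : set H :=
  [set q | exists z I, [/\ D z, sphere I & q = point z I]].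

Definition circular_domain (D : set R[i]) :=
  [/\ conj_invariant D, open (circularization D) &
      connected (circularization D)].

(* Functions on D and on Omega_D are represented by total functions whose
   values outside D, resp. Omega_D, are irrelevant. *)

Definition stem (D : set R[i]) (F : R[i] -> HC) :=
  forall z, D z -> F z^* = conjHC (F z).

Definition induces (D : set R[i]) (F : R[i] -> HC) (f : H -> H) :=
  forall z I, D z -> sphere I -> f (point z I) = (F z).1 + I * (F z).2.

(* For a stem function F on D, there is one induced function up to its values
   outside Omega_D. *)
Definition slice (D : set R[i]) (F : R[i] -> HC) : H -> H :=
  get [set f | induces D F f].

(* For a slice function f on Omega_D, there is one stem function inducing f, up
   to its values outside D. *)
Definition stem_of (D : set R[i]) (f : H -> H) : R[i] -> HC :=
  get [set F | stem D F /\ induces D F f].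

(* Complex differentiability at every point of D, which is open in C whenever
   Omega_D is open in H. *)
Definition holomorphic (D : set R[i]) (F : R[i] -> HC) :=
  forall z, D z ->
    exists l : HC,
      (fun h : R[i]^o => scaleHC h^-1 (F (z + h) - F z)) @ (0 : R[i]^o)^' --> l.

Definition slice_regular (D : set R[i]) (f : H -> H) :=
  exists F, [/\ stem D F, holomorphic D F & induces D F f].

Definition star (D : set R[i]) (f g : H -> H) : H -> H :=
  slice D (fun z => mulHC (stem_of D f z) (stem_of D g z)).

Definition starX (D : set R[i]) (f : H -> H) (n : nat) : H -> H :=
  iter n (star D f) (fun=> 1).

Definition sconj (D : set R[i]) (f : H -> H) : H -> H :=
  slice D (fun z => (conjq (stem_of D f z).1, conjq (stem_of D f z).2)).

Definition repart (D : set R[i]) (f : H -> H) : H -> H :=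
  fun q => 2^-1 *: (f q + sconj D f q).

Definition vecpart (D : set R[i]) (f : H -> H) : H -> H :=
  fun q => 2^-1 *: (f q - sconj D f q).

Definition symm (D : set R[i]) (f : H -> H) : H -> H := star D f (sconj D f).

Definition expstar (D : set R[i]) (f : H -> H) : H -> H :=
  fun q => limn (series (fun n => (n`!%:R^-1 : R) *: starX D f n q)).

(* The power of the slice-preserving function [f_v^s] is pointwise. *)
Definition mu (D : set R[i]) (f : H -> H) : H -> H :=
  fun q => limn (series (fun m =>
    ((-1) ^+ m / (2 * m)%N`!%:R : R) *: symm D (vecpart D f) q ^+ m)).

Definition nu (D : set R[i]) (f : H -> H) : H -> H :=
  fun q => limn (series (fun m =>
    ((-1) ^+ m / (2 * m + 1)%N`!%:R : R) *: symm D (vecpart D f) q ^+ m)).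

End SliceFunctions.

(* Main.v *)
Require Import Defs.
From HB Require Import structures.
From mathcomp Require Import all_boot all_order all_algebra.
From mathcomp Require Import complex.
From mathcomp Require Import all_classical all_reals all_analysis.
From mathcomp Require Import ring lra.
Import Order.TTheory GRing.Theory Num.Theory numFieldNormedType.Exports.
Set Implicit Arguments.
Unset Strict Implicit.
Unset Printing Implicit Defensive.
Local Open Scope classical_set_scope.
Local Open Scope ring_scope.

(** The $*$-operations on slice functions are the pointwise operations on their
    stem functions, and every identity to be proved holds already at the level
    of the values [w = F z] of a stem function, in the complexified quaternions
    [biquat R], an associative real algebra of dimension 8.  So the proof has
    two halves.

    In the algebra, [expb w], the sum of the series of the [w ^+ n / n!],
    satisfies [expb (x + y) = expb x * expb y] for commuting [x] and [y]
    ([expbD]): the difference between the product of two partial sums and the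
    partial sum for [x + y] is bounded, up to a constant, by the same difference
    for real arguments, which tends to 0 because the real exponential satisfies
    the same law.  An element [w] is the sum of [rpart w], fixed by
    quaternionic conjugation, hence complex and central, and of [vpart w], sent
    to its opposite by conjugation; conjugation is a continuous
    antiautomorphism, so [expb (bconj w)] is the conjugate of [expb w].
    Therefore
    - [expb w * bconj (expb w) = expb (w + bconj w) = expb (2 *: rpart w)];
    - [expb w] and [expb (bconj w)] are [expb (rpart w)] times [expb v] and
      [expb (- v)] with [v = vpart w].  As [v ^+ 2 = - (v * bconj v)], the even
      part of the exponential series of [v] is the series of [mu] in
      [v * bconj v], and its odd part is the series of [nu] times [v];
    - [expb w * expb (- w) = expb 0 = 1].

    To transfer this to functions, [ev I : (p, q) |-> p + I q] evaluates a stem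
    value at a point of the slice of [I].  It is linear and continuous, but
    not multiplicative.  It does respect products whose left factor is fixed by
    conjugation ([evM_real]), which is the case for [expb (rpart w)] and for
    the sums of the series [mu] and [nu].  The relation [has_stem] follows each
    operation on slice functions back to the corresponding operation on stem
    functions; it rests on the existence and uniqueness of the function induced
    by a stem function and of the stem function inducing a given function.
    Finally [exp_* f] has no zero: if [ev I] kills a left factor then it kills the
    product ([evM_eq0]), whereas it maps [expb w * expb (- w)] to 1. *)

(** * The algebra of complexified quaternions *)

(** The product of two rings already carries the componentwise multiplication;
    the separate name lets the pairs carry [mulHC] instead, while keeping the
    norm and the vector space structure of the product. *)
Definition biquat (R : realType) := (quat R * quat R)%type.

HB.instance Definition _ (R : realType) :=
  NormedModule.copy (biquat R) (quat R * quat R)%type.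

Section Biquaternions.
Variable R : realType.

Definition mulb (x y : biquat R) : biquat R := mulHC x y.

Definition oneb : biquat R := (1, 0).

Fact mulbA : associative mulb.
Proof.
move=> x y z; rewrite /mulb /mulHC /=; congr pair;
  rewrite !(mulrDl, mulrDr, mulNr, mulrN, mulrBl, mulrBr, mulrA).
  by rewrite !opprD -!addrA; congr (_ + _); rewrite [RHS]addrC -addrA.
by rewrite -!addrA; congr (_ + _); rewrite [RHS]addrC addrA.
Qed.

Fact mul1b : left_id oneb mulb.
Proof.
by case=> p q; rewrite /mulb /oneb /mulHC /= !mul1r !mul0r subr0 addr0.
Qed.

Fact mulb1 : right_id oneb mulb.
Proof.
by case=> p q; rewrite /mulb /oneb /mulHC /= !mulr1 !mulr0 subr0 add0r.
Qed.

Fact mulbDl : left_distributive mulb +%R.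
Proof.
by move=> x y z; congr pair; rewrite /= !mulrDl ?opprD addrACA.
Qed.

Fact mulbDr : right_distributive mulb +%R.
Proof.
by move=> x y z; congr pair; rewrite /= !mulrDr ?opprD addrACA.
Qed.

Fact oneb_neq0 : oneb != 0.
Proof. by apply/eqP => -[/eqP]; rewrite oner_eq0. Qed.

HB.instance Definition _ := GRing.Zmodule_isNzRing.Build (biquat R)
  mulbA mul1b mulb1 mulbDl mulbDr oneb_neq0.

Fact scalebAl (k : R) (p q : biquat R) : k *: mulb p q = mulb (k *: p) q.
Proof. by congr pair; rewrite /= ?(scalerBr, scalerDr) !scalerAl. Qed.

HB.instance Definition _ :=
  GRing.LSemiModule_isLSemiAlgebra.Build R (biquat R) scalebAl.

Fact scalebAr (k : R) (p q : biquat R) : k *: mulb p q = mulb p (k *: q).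
Proof. by congr pair; rewrite /= ?(scalerBr, scalerDr) !scalerAr. Qed.

HB.instance Definition _ :=
  GRing.LSemiAlgebra_isSemiAlgebra.Build R (biquat R) scalebAr.

(** * Norm estimates and convergence *)

Lemma cvg_norm_sub_le (V : normedModType R) (u : nat -> V) (l : V)
    (b : nat -> R) :
  (forall n, `|u n - l| <= b n) -> b n @[n --> \oo] --> (0 : R) ->
  u n @[n --> \oo] --> l.
Proof.
move=> ub b0; apply/subr_cvg0/norm_cvg0P.
apply: (squeeze_cvgr _ (cvg_cst 0) b0).
by apply: nearW => n; rewrite normr_ge0 ub.
Qed.

Lemma cvg_norm_sub (V : normedModType R) (u : nat -> V) (l : V) :
  u n @[n --> \oo] --> l -> `|u n - l| @[n --> \oo] --> (0 : R).
Proof. by move=> ul; apply/norm_cvg0P/subr_cvg0. Qed.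

Lemma cvg_bounded_additive (V W : normedModType R) (g : V -> W) (C : R)
    (u : nat -> V) (l : V) :
  zmod_morphism g -> (forall x, `|g x| <= C * `|x|) ->
  u n @[n --> \oo] --> l -> g (u n) @[n --> \oo] --> g l.
Proof.
move=> gB gC ul; apply: (cvg_norm_sub_le (b := fun n => C * `|u n - l|)).
  by move=> n; rewrite -gB gC.
have := cvgMr (a := C) (cvg_norm_sub ul); rewrite mulr0; exact.
Qed.

Lemma norm_entry_le (q : quat R) (j : 'I_4) : `|q ord0 j| <= `|q|.
Proof.
rewrite [leRHS]/Num.Def.normr /= mx_normrE.
exact: (le_bigmax _ (fun ij : 'I_1 * 'I_4 => `|q ij.1 ij.2|) (ord0, j)).
Qed.

(** The norm is the largest absolute value of a coordinate, and each coordinate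
    of a product is a signed sum of four products of coordinates. *)
Lemma norm_mulq_le (p q : quat R) : `|p * q| <= 4 * `|p| * `|q|.
Proof.
have M i j : `|p ord0 i * q ord0 j| <= `|p| * `|q|.
  by rewrite normrM ler_pM // norm_entry_le.
rewrite [leLHS]/Num.Def.normr /= mx_normrE.
apply: bigmax_le => [|[i j] _ /=]; first by rewrite !mulr_ge0.
have -> : (4 * `|p| * `|q| : R) =
   `|p| * `|q| + `|p| * `|q| + `|p| * `|q| + `|p| * `|q| by ring.
case: j => [[|[|[|[|//]]]] h]; rewrite mxE /=;
  repeat (apply: le_trans (ler_normD _ _) _; rewrite ?normrN;
    apply: lerD => //); try exact: M.
Qed.

Lemma norm_fst_le (x : biquat R) : `|x.1| <= `|x|.
Proof. by rewrite [leRHS]prod_normE le_max lexx. Qed.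

Lemma norm_snd_le (x : biquat R) : `|x.2| <= `|x|.
Proof. by rewrite [leRHS]prod_normE le_max lexx orbT. Qed.

Lemma norm_mulb_le (x y : biquat R) : `|x * y| <= 8 * `|x| * `|y|.
Proof.
have M (p q : quat R) : `|p| <= `|x| -> `|q| <= `|y| ->
    `|p * q| <= 4 * `|x| * `|y|.
  move=> px qy; apply: le_trans (norm_mulq_le _ _) _.
  by rewrite ler_pM ?mulr_ge0 ?ler_wpM2l.
have -> : (8 * `|x| * `|y| : R) = 4 * `|x| * `|y| + 4 * `|x| * `|y| by ring.
rewrite [leLHS]prod_normE ge_max; apply/andP; split;
  apply: le_trans (ler_normD _ _) _; rewrite ?normrN; apply: lerD;
  by apply: M; rewrite ?norm_fst_le ?norm_snd_le.
Qed.

Lemma norm_oneb : `|1 : biquat R| <= 1.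
Proof.
rewrite prod_normE /= normr0 ge_max ler01 andbT.
rewrite [leLHS]/Num.Def.normr /= mx_normrE.
apply: bigmax_le => [//|[i j] _ /=]; rewrite mxE.
by case: j => [[|[|[|[|//]]]] h] /=; rewrite ?normr1 ?normr0.
Qed.

(** The norm is submultiplicative only up to the factor 8; rescaling it by 8
    absorbs this factor in the powers. *)
Lemma norm_exprb_le (x : biquat R) n : `|x ^+ n| <= (8 * `|x|) ^+ n.
Proof.
elim: n => [|n IH]; first exact: norm_oneb.
rewrite !exprS; apply: le_trans (norm_mulb_le _ _) _.
by rewrite ler_wpM2l // mulr_ge0.
Qed.

(** Completeness is used on each of the two quaternionic components. *)
Lemma is_cvg_series_biquat (u : nat -> biquat R) (b : nat -> R) :
  (forall n, `|u n| <= b n) -> cvgn (series b) -> cvgn (series u).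
Proof.
move=> ub cb.
have b0 n : 0 <= b n by apply: (le_trans _ (ub n)); rewrite normr_ge0.
have c1 : cvgn (series (fun n => (u n).1)).
  apply: normed_cvg; apply: series_le_cvg cb => // n /=; first exact: normr_ge0.
  exact: le_trans (norm_fst_le _) (ub n).
have c2 : cvgn (series (fun n => (u n).2)).
  apply: normed_cvg; apply: series_le_cvg cb => // n /=; first exact: normr_ge0.
  exact: le_trans (norm_snd_le _) (ub n).
have -> : series u =
    fun n => (series (fun n => (u n).1) n, series (fun n => (u n).2) n).
  apply/funext => n; elim: n => [|n IH]; first by rewrite /series /= !big_geq.
  by rewrite [LHS]seriesSr IH !seriesSr.
apply/cvg_ex; exists (limn (series (fun n => (u n).1)),
  limn (series (fun n => (u n).2))).
exact: (cvg_pair c1 c2).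
Qed.

(** * The exponential of a sum *)

(** The product of two partial sums exceeds the partial sum of the Cauchy
    product by the terms of the square that lie beyond its antidiagonal.  The
    identity is kept at the level of rings because it is used twice: in the
    algebra and, for the majorant, in the real numbers. *)
Lemma cauchy_sumB (A : nzRingType) (u v : nat -> A) n :
  (\sum_(i < n) u i) * (\sum_(j < n) v j)
    - \sum_(k < n) \sum_(i < k.+1) u i * v (k - i)%N
  = \sum_(i < n) \sum_(j < n | (n <= i + j)%N) u i * v j.
Proof.
have -> : \sum_(k < n) \sum_(i < k.+1) u i * v (k - i)%N
    = \sum_(i < n) \sum_(j < n | (i + j < n)%N) u i * v j.
  transitivity (\sum_(k < n) \sum_(i < n | (i <= k)%N) u i * v (k - i)%N).
    apply: eq_bigr => k _.
    by rewrite (big_ord_widen n (fun i => u i * v (k - i)%N)).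
  rewrite (exchange_big_dep xpredT) //=; apply: eq_bigr => i _.
  rewrite -(big_mkord (fun k => (i <= k)%N) (fun k => u i * v (k - i)%N)).
  rewrite -(big_mkord (fun j => (i + j < n)%N) (fun j => u i * v j)).
  transitivity (\sum_(i <= k < n) u i * v (k - i)%N).
    by rewrite [RHS](@big_nat_widenl _ _ _ _ 0).
  rewrite -{1}[val i]add0n big_addn.
  rewrite (@big_nat_widen _ _ _ 0 _ n) ?leq_subr //=.
  by apply: eq_big => [j|j _]; rewrite ?addnK // ltn_subRL addnC.
rewrite big_distrl -sumrB /=; apply: eq_bigr => i _.
rewrite big_distrr /= [X in X - _](bigID (fun j : 'I_n => (i + j < n)%N)) /=.
rewrite addrAC subrr add0r; apply: eq_bigl => j.
by rewrite -leqNgt.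
Qed.

Definition expcoef (A : algType R) (x : A) (n : nat) : A :=
  (n`!%:R^-1 : R) *: x ^+ n.

Lemma expcoefD (A : algType R) (x y : A) n : GRing.comm x y ->
  expcoef (x + y) n = \sum_(i < n.+1) expcoef x i * expcoef y (n - i)%N.
Proof.
move=> cxy; rewrite /expcoef addrC exprDn_comm; last exact/commr_sym.
rewrite scaler_sumr; apply: eq_bigr => i _.
have cxyi : x ^+ i * y ^+ (n - i) = y ^+ (n - i) * x ^+ i.
  by apply: commrX; apply: commr_sym; exact: commrX.
rewrite -scalerAl -scalerAr scalerA -scalerMnr scalerMnl cxyi -mulr_natr.
congr (_ *: _).
have lein : (i <= n)%N by rewrite -ltnS.
rewrite -(bin_fact lein) !natrM; field.
by rewrite !pnatr_eq0 -!lt0n !fact_gt0 bin_gt0.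
Qed.

Lemma norm_expcoef_le (x : biquat R) n :
  `|expcoef x n| <= exp_coeff (8 * `|x|) n.
Proof.
rewrite /expcoef normrZ ger0_norm ?invr_ge0 ?ler0n // /exp_coeff /= mulrC.
by rewrite ler_wpM2r ?invr_ge0 ?ler0n ?norm_exprb_le.
Qed.

(** Comparison with the real exponential series covers at once the series of
    the exponential, of [mu] and of [nu]. *)
Lemma is_cvg_powser (c : nat -> R) (x : biquat R) :
  (forall n, `|c n| <= n`!%:R^-1) -> cvgn (series (fun n => c n *: x ^+ n)).
Proof.
move=> cle.
apply: (is_cvg_series_biquat _ (is_cvg_series_exp_coeff (8 * `|x|))).
move=> n; rewrite normrZ /exp_coeff /= mulrC.
by rewrite ler_pM ?norm_exprb_le.
Qed.

Definition powser (c : nat -> R) (x : biquat R) : biquat R :=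
  limn (series (fun n => c n *: x ^+ n)).

Lemma cvg_powser c x : (forall n, `|c n| <= n`!%:R^-1) ->
  series (fun n => c n *: x ^+ n) n @[n --> \oo] --> powser c x.
Proof. exact: is_cvg_powser. Qed.

Definition expb : biquat R -> biquat R := powser (fun n => n`!%:R^-1).

Lemma exp_coef_le n : `|n`!%:R^-1 : R| <= n`!%:R^-1.
Proof. by rewrite ger0_norm ?invr_ge0 ?ler0n. Qed.

Lemma cvg_expb (x : biquat R) : series (expcoef x) n @[n --> \oo] --> expb x.
Proof. exact: cvg_powser exp_coef_le. Qed.

Lemma cvg_biquat_unique (u : nat -> biquat R) (a b : biquat R) :
  u n @[n --> \oo] --> a -> u n @[n --> \oo] --> b -> a = b.
Proof. by apply: cvg_unique; exact: norm_hausdorff. Qed.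

Lemma cvg_mulb (u v : nat -> biquat R) (a b : biquat R) :
  u n @[n --> \oo] --> a -> v n @[n --> \oo] --> b ->
  u n * v n @[n --> \oo] --> a * b.
Proof.
move=> ua vpart.
apply: (cvg_norm_sub_le
  (b := fun n => 8 * (`|u n - a| * `|v n|) + 8 * (`|a| * `|v n - b|))).
  move=> n; have -> : u n * v n - a * b = (u n - a) * v n + a * (v n - b).
    by rewrite mulrBl mulrBr addrA subrK.
  by apply: le_trans (ler_normD _ _) _; rewrite !mulrA lerD ?norm_mulb_le.
rewrite -[X in _ --> X](_ : 8 * (0 * `|b|) + 8 * (`|a| * 0) = 0); last first.
  by rewrite mul0r !mulr0 addr0.
apply: cvgD; apply: cvgMr.
  by apply: cvgM; [exact: cvg_norm_sub | exact: cvg_norm].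
by apply: cvgMr; exact: cvg_norm_sub.
Qed.

(** By [cauchy_sumB] the defect of multiplicativity of the partial sums is a sum
    of terms [x ^+ i * y ^+ j / (i! j!)], whose norms are at most 8 times the
    corresponding real terms for [8 |x|] and [8 |y|]; the sum of these is the
    same defect for the real exponential, which tends to 0. *)
Lemma expbD (x y : biquat R) : GRing.comm x y -> expb (x + y) = expb x * expb y.
Proof.
move=> cxy; pose S z n := series (expcoef (z : biquat R)) n.
pose a := 8 * `|x|; pose b := 8 * `|y|.
pose T (t : R) n := series (exp_coeff t) n.
have dT : T a n * T b n - T (a + b) n @[n --> \oo] --> (0 : R).
  have h t : T t n @[n --> \oo] --> expR t by exact: is_cvg_series_exp_coeff.
  rewrite -(subrr (expR (a + b))) {1}expRD.
  by apply: cvgB; [apply: cvgM|]; exact: h.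
have dS : S x n * S y n - S (x + y) n @[n --> \oo] --> (0 : biquat R).
  have dT8 : 8 * (T a n * T b n - T (a + b) n) @[n --> \oo] --> (0 : R).
    by have := cvgMr (a := 8) dT; rewrite mulr0; exact.
  apply: cvg_norm_sub_le dT8 => n; rewrite subr0.
  have conv (A : algType R) (s t : A) : GRing.comm s t ->
    series (expcoef s) n * series (expcoef t) n - series (expcoef (s + t)) n =
    \sum_(i < n) \sum_(j < n | (n <= i + j)%N) expcoef s i * expcoef t j.
    move=> cst; rewrite !seriesEord /= -cauchy_sumB; congr (_ - _).
    by apply: eq_bigr => k _; rewrite expcoefD.
  (* The real numbers enter as an algebra over themselves. *)
  have TE t : T t n = series (expcoef (t : R^o)) n.
    by rewrite /T exp_coeffE.
  rewrite !TE (conv R^o); last exact: mulrC.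
  rewrite conv // mulr_sumr; apply: le_trans (ler_norm_sum _ _ _) _.
  apply: ler_sum => i _; rewrite mulr_sumr.
  apply: le_trans (ler_norm_sum _ _ _) _; apply: ler_sum => j _.
  apply: le_trans (norm_mulb_le _ _) _.
  rewrite mulrA ler_pM ?mulr_ge0 //; last first.
    by apply: le_trans (norm_expcoef_le _ _) _; rewrite exp_coeffE.
  rewrite ler_wpM2l //.
  by apply: le_trans (norm_expcoef_le _ _) _; rewrite exp_coeffE.
have SS : S x n * S y n @[n --> \oo] --> expb x * expb y.
  by apply: cvg_mulb; exact: cvg_expb.
apply: (cvg_biquat_unique (u := series (expcoef (x + y)))).
  exact: cvg_expb.
rewrite -[X in _ --> X]subr0.
have -> : series (expcoef (x + y)) =
    fun n => S x n * S y n - (S x n * S y n - S (x + y) n).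
  by apply/funext => n; rewrite subKr.
exact: cvgB SS dS.
Qed.

(** * Conjugations and evaluation *)

(** A bounded linear map goes through the limit of the partial sums. *)
Lemma cvg_map_powser (V : normedModType R) (g : biquat R -> V) (C : R) c x :
  zmod_morphism g -> (forall k y, g (k *: y) = k *: g y) ->
  (forall y, `|g y| <= C * `|y|) -> (forall n, `|c n| <= n`!%:R^-1) ->
  series (fun n => c n *: g (x ^+ n)) n @[n --> \oo] --> g (powser c x).
Proof.
move=> gB gZ gC cle.
have := cvg_bounded_additive gB gC (cvg_powser (x := x) cle).
have g0 : g 0 = 0 by rewrite -(subrr 0) gB subrr.
have gD y z : g (y + z) = g y + g z.
  have gN t : g (- t) = - g t by rewrite -sub0r gB g0 sub0r.
  by rewrite -{1}[z]opprK gB gN opprK.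
rewrite (_ : (fun n => g _) = series (fun n => c n *: g (x ^+ n))) //.
apply/funext; elim => [|n IH]; first by rewrite /series /= !big_geq.
by rewrite !seriesSr gD gZ IH.
Qed.

Definition bconj (x : biquat R) : biquat R := (conjq x.1, conjq x.2).

Lemma conjqZ k (p : quat R) : conjq (k *: p) = k *: conjq p.
Proof. by apply: quatP; rewrite !(quatZE, mkquatE) ?mulrN. Qed.

Lemma conjqD (p q : quat R) : conjq (p + q) = conjq p + conjq q.
Proof. by apply: quatP; rewrite !(quatDE, mkquatE) ?opprD. Qed.

Lemma conjqB (p q : quat R) : conjq (p - q) = conjq p - conjq q.
Proof. by rewrite conjqD -scaleN1r conjqZ scaleN1r. Qed.

Lemma conjqM (p q : quat R) : conjq (p * q) = conjq q * conjq p.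
Proof. by apply: quatP; rewrite !mkquatE; ring. Qed.

Lemma conjqK (p : quat R) : conjq (conjq p) = p.
Proof. by apply: quatP; rewrite !mkquatE ?opprK. Qed.

Lemma conjq_real (p : quat R) : conjq p = p -> p = (q0 p)%:A.
Proof.
have h (t : R) : - t = t -> t = 0.
  by move=> /eqP; rewrite -subr_eq0 -opprD oppr_eq0 -mulr2n mulrn_eq0 => /eqP.
move=> pE; apply: quatP; rewrite quatZE !mkquatE ?mulr1 ?mulr0 //; apply: h;
  by rewrite -[RHS](congr1 (@q1 R) pE, congr1 (@q2 R) pE, congr1 (@q3 R) pE)
             !mkquatE.
Qed.

Lemma norm_conjq (p : quat R) : `|conjq p| <= `|p|.
Proof.
rewrite [leLHS]/Num.Def.normr /= mx_normrE.
apply: bigmax_le => [//|[i j] _ /=].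
by case: j => [[|[|[|[|//]]]] h]; rewrite mxE /= ?normrN norm_entry_le.
Qed.

Lemma bconjB : zmod_morphism bconj.
Proof. by move=> x y; congr pair; rewrite /= conjqB. Qed.

Lemma bconjZ k x : bconj (k *: x) = k *: bconj x.
Proof. by congr pair; rewrite /= conjqZ. Qed.

Lemma bconjK x : bconj (bconj x) = x.
Proof. by case: x => p q; rewrite /bconj /= !conjqK. Qed.

Lemma bconjD x y : bconj (x + y) = bconj x + bconj y.
Proof. by congr pair; rewrite /= conjqD. Qed.

Lemma bconjM x y : bconj (x * y) = bconj y * bconj x.
Proof. by congr pair; rewrite /= ?conjqB ?conjqD !conjqM // addrC. Qed.

Lemma bconj1 : bconj 1 = 1.
Proof.
by congr pair; apply: quatP;
  rewrite !mkquatE ?oppr0 // /q0 /q1 /q2 /q3 mxE ?oppr0.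
Qed.

Lemma norm_bconj x : `|bconj x| <= 1 * `|x|.
Proof.
rewrite mul1r [leLHS]prod_normE ge_max; apply/andP; split.
  exact: le_trans (norm_conjq _) (norm_fst_le _).
exact: le_trans (norm_conjq _) (norm_snd_le _).
Qed.

Lemma bconjX x n : bconj (x ^+ n) = bconj x ^+ n.
Proof.
by elim: n => [|n IH]; [exact: bconj1 | rewrite exprSr bconjM IH -exprS].
Qed.

Lemma bconj_powser c x : (forall n, `|c n| <= n`!%:R^-1) ->
  bconj (powser c x) = powser c (bconj x).
Proof.
move=> cle.
have := cvg_map_powser (x := x) bconjB bconjZ norm_bconj cle.
have -> : (fun n => c n *: bconj (x ^+ n)) = (fun n => c n *: bconj x ^+ n).
  by apply/funext => n; rewrite bconjX.
by move/cvg_biquat_unique; apply; exact: cvg_powser.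
Qed.

(** Complex conjugation of the second tensor factor, as a self-map of the
    algebra: it is the operation in the definition of stem functions. *)
Definition iconj (x : biquat R) : biquat R := conjHC x.

Lemma iconjB : zmod_morphism iconj.
Proof. by move=> x y; congr pair; rewrite /= opprD. Qed.

Lemma iconjZ k x : iconj (k *: x) = k *: iconj x.
Proof. by congr pair; rewrite /= scalerN. Qed.

Lemma iconjM x y : iconj (x * y) = iconj x * iconj y.
Proof. by congr pair; rewrite /= ?mulrNN // mulrN mulNr opprD. Qed.

Lemma iconjX x n : iconj (x ^+ n) = iconj x ^+ n.
Proof.
by elim: n => [|n IH]; [congr pair; rewrite /= oppr0 | rewrite !exprS iconjM IH].
Qed.

Lemma norm_iconj x : `|iconj x| <= 1 * `|x|.
Proof. by rewrite mul1r [leLHS]prod_normE /= normrN [leRHS]prod_normE. Qed.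

Lemma iconj_powser c x : (forall n, `|c n| <= n`!%:R^-1) ->
  iconj (powser c x) = powser c (iconj x).
Proof.
move=> cle.
have := cvg_map_powser (x := x) iconjB iconjZ norm_iconj cle.
have -> : (fun n => c n *: iconj (x ^+ n)) = (fun n => c n *: iconj x ^+ n).
  by apply/funext => n; rewrite iconjX.
by move/cvg_biquat_unique; apply; exact: cvg_powser.
Qed.

(** The elements fixed by [bconj] have real components: they form the centre, a
    copy of the complex numbers. *)
Lemma bconj_fixed_comm x y : bconj x = x -> x * y = y * x.
Proof.
case: x => a b [/conjq_real -> /conjq_real ->].
by congr pair; rewrite /= -!scalerAl -!scalerAr !mul1r !mulr1 // addrC.
Qed.

Definition ev (I : quat R) (x : biquat R) : quat R := x.1 + I * x.2.

Lemma evB I : zmod_morphism (ev I).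
Proof. by move=> x y; rewrite /ev /= mulrBr addrACA opprD. Qed.

Lemma evD I x y : ev I (x + y) = ev I x + ev I y.
Proof. by rewrite /ev /= mulrDr addrACA. Qed.

Lemma evZ I k x : ev I (k *: x) = k *: ev I x.
Proof. by rewrite /ev /= scalerDr scalerAr. Qed.

Lemma ev1 I : ev I 1 = 1.
Proof. by rewrite /ev /= mulr0 addr0. Qed.

Lemma norm_ev I x : `|ev I x| <= (1 + 4 * `|I|) * `|x|.
Proof.
apply: le_trans (ler_normD _ _) _; rewrite mulrDl mul1r lerD ?norm_fst_le //.
apply: le_trans (norm_mulq_le _ _) _.
by rewrite ler_wpM2l ?mulr_ge0 ?norm_snd_le.
Qed.

(** In general [ev I] fails to be multiplicative because [I] has to be moved past
    the components of the left factor; those of [x] are real. *)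
Lemma evM_real I x y : sphere I -> bconj x = x ->
  ev I (x * y) = ev I x * ev I y.
Proof.
case: x => a b; rewrite /sphere /= expr2 => I2 [/conjq_real -> /conjq_real ->].
rewrite /ev /= !mulrDl !mulrDr -!scalerAl -!scalerAr !mul1r !mulr1.
rewrite -!scalerAl mulrA I2 mulN1r scalerN scalerAr.
by rewrite -!addrA; congr (_ + _); rewrite addrC -addrA.
Qed.

(** If [x.1 = - I * x.2] then every term of the evaluated product occurs twice,
    with opposite signs: a zero of the left factor is a zero of a
    $*$-product. *)
Lemma evM_eq0 I x y : sphere I -> ev I x = 0 -> ev I (x * y) = 0.
Proof.
rewrite /sphere /= expr2 => I2 /eqP; rewrite addr_eq0 => /eqP x1.
rewrite /ev /= x1 !mulNr mulrDr mulrN !mulrA I2 mulN1r mulNr opprK.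
by rewrite addrA subrK addNr.
Qed.

Lemma evX_real I x n : sphere I -> bconj x = x -> ev I (x ^+ n) = ev I x ^+ n.
Proof.
move=> hI xr; elim: n => [|n IH]; first exact: ev1.
by rewrite !exprS evM_real // IH.
Qed.

Lemma ev_powser I c x : (forall n, `|c n| <= n`!%:R^-1) ->
  series (fun n => c n *: ev I (x ^+ n)) n @[n --> \oo] --> ev I (powser c x).
Proof. exact: (cvg_map_powser (@evB I) (@evZ I) (norm_ev I)). Qed.

Lemma expb0 : expb (0 : biquat R) = 1.
Proof.
apply: (cvg_biquat_unique (u := series (expcoef (0 : biquat R)))).
  exact: cvg_expb.
(* All partial sums are 1 except the empty one. *)
apply: (cvg_norm_sub_le (b := fun n => (n == 0)%:R)); last first.
  by apply: cvg_near_cst; exists 1%N => // -[].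
case=> [|n]; first by rewrite /series /= big_geq // sub0r normrN norm_oneb.
rewrite /series /= big_nat_recl //= big1 => [|i _].
  by rewrite addr0 /expcoef fact0 invr1 scale1r expr0 subrr normr0.
by rewrite /expcoef exprS mul0r scaler0.
Qed.

(** * Even and odd parts of the exponential *)

Definition cos_coef m : R := (-1) ^+ m / (2 * m)%N`!%:R.

Definition sin_coef m : R := (-1) ^+ m / (2 * m + 1)%N`!%:R.

Lemma alt_coef_le k m : (m <= k)%N -> `|(-1) ^+ m / k`!%:R : R| <= m`!%:R^-1.
Proof.
move=> mk; rewrite normrM normrX normrN1 expr1n mul1r ger0_norm ?invr_ge0 //.
by rewrite lef_pV2 ?posrE ?ltr0n ?fact_gt0 // ler_nat leq_fact.
Qed.

Lemma cos_coef_le m : `|cos_coef m| <= m`!%:R^-1.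
Proof. by apply: alt_coef_le; rewrite mul2n -addnn leq_addr. Qed.

Lemma sin_coef_le m : `|sin_coef m| <= m`!%:R^-1.
Proof. by apply: alt_coef_le; rewrite mul2n -addnn -addnA leq_addr. Qed.

Lemma exprb_sqr (v s : biquat R) m : v ^+ 2 = - s ->
  v ^+ (2 * m) = (-1) ^+ m *: s ^+ m.
Proof. by move=> vs; rewrite exprM vs -scaleN1r exprZn. Qed.

Lemma expcoefN (v : biquat R) n : expcoef (- v) n = (-1) ^+ n *: expcoef v n.
Proof. by rewrite /expcoef -scaleN1r exprZn !scalerA mulrC. Qed.

Lemma cvg_even (u : nat -> biquat R) (l : biquat R) :
  u n @[n --> \oo] --> l -> u (2 * n)%N @[n --> \oo] --> l.
Proof. by move=> ul; apply: cvg_comp ul; exact: cvg_mulnl. Qed.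

Lemma series_pairs (u : nat -> biquat R) n :
  series u (2 * n)%N = series (fun m => u (2 * m)%N + u (2 * m).+1) n.
Proof.
elim: n => [|n IH]; first by rewrite /series /= !big_geq.
by rewrite [RHS]seriesSr -IH mulnS [LHS]seriesSr seriesSr addrA.
Qed.

Lemma half_scaleDD (V : lmodType R) (x : V) : 2^-1 *: (x + x) = x.
Proof.
by rewrite -mulr2n -scalerMnr scalerMnl -mulr_natr mulVf ?scale1r ?pnatr_eq0.
Qed.

Lemma expcoef_even (v s : biquat R) m : v ^+ 2 = - s ->
  expcoef v (2 * m)%N = cos_coef m *: s ^+ m.
Proof. by move=> vs; rewrite /expcoef (exprb_sqr _ vs) scalerA mulrC. Qed.

Lemma expcoef_odd (v s : biquat R) m : v ^+ 2 = - s ->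
  expcoef v (2 * m).+1 = sin_coef m *: s ^+ m * v.
Proof.
move=> vs; rewrite /expcoef exprSr (exprb_sqr _ vs) -scalerAl scalerA mulrC.
by rewrite /sin_coef addn1 scalerAl.
Qed.

Lemma sign_even m : (-1) ^+ (2 * m) = 1 :> R.
Proof. by rewrite -signr_odd mul2n odd_double. Qed.

Lemma sign_odd m : (-1) ^+ (2 * m).+1 = -1 :> R.
Proof. by rewrite exprS sign_even mulr1. Qed.

(** In the partial sums of even length of the two series the odd terms cancel,
    and the even powers of [v] are powers of [- s]. *)
Lemma expb_even_part (v s : biquat R) : v ^+ 2 = - s ->
  2^-1 *: (expb v + expb (- v)) = powser cos_coef s.
Proof.
move=> vs; apply: cvg_biquat_unique (cvg_powser (x := s) cos_coef_le).
have h : 2^-1 *: (series (expcoef v) n + series (expcoef (- v)) n)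
   @[n --> \oo] --> 2^-1 *: (expb v + expb (- v)).
  by apply: cvgZl_tmp; apply: cvgD; exact: cvg_expb.
have := cvg_even h.
rewrite (_ : (fun n => _) = series (fun n => cos_coef n *: s ^+ n)) //.
apply/funext => n; rewrite !series_pairs /series /= -big_split scaler_sumr /=.
apply: eq_bigr => m _; rewrite !expcoefN sign_even sign_odd scale1r scaleN1r.
by rewrite addrACA subrr addr0 half_scaleDD (expcoef_even _ vs).
Qed.

(** Here [v] need not be invertible, so the convergence of the series in [s] does
    not follow from that of the exponential series and is used separately. *)
Lemma expb_odd_part (v s : biquat R) : v ^+ 2 = - s ->
  2^-1 *: (expb v - expb (- v)) = powser sin_coef s * v.
Proof.
move=> vs; apply: (cvg_biquat_unique
  (u := fun n => series (fun n => sin_coef n *: s ^+ n) n * v)); last first.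
  by apply: cvg_mulb; [exact: cvg_powser sin_coef_le | exact: cvg_cst].
have h : 2^-1 *: (series (expcoef v) n - series (expcoef (- v)) n)
   @[n --> \oo] --> 2^-1 *: (expb v - expb (- v)).
  by apply: cvgZl_tmp; apply: cvgB; exact: cvg_expb.
have := cvg_even h.
rewrite (_ : (fun n => _) =
  fun n => series (fun n => sin_coef n *: s ^+ n) n * v) //.
apply/funext => n.
rewrite !series_pairs /series /= -sumrB scaler_sumr mulr_suml.
apply: eq_bigr => m _; rewrite !expcoefN sign_even sign_odd scale1r scaleN1r.
by rewrite opprD opprK addrACA subrr add0r half_scaleDD (expcoef_odd _ vs).
Qed.

(** * Splitting into central and vectorial parts *)

Definition rpart (w : biquat R) : biquat R := 2^-1 *: (w + bconj w).

Definition vpart (w : biquat R) : biquat R := 2^-1 *: (w - bconj w).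

Lemma rpart_real w : bconj (rpart w) = rpart w.
Proof. by rewrite bconjZ bconjD bconjK addrC. Qed.

Lemma rpartD_vpart w : rpart w + vpart w = w.
Proof. by rewrite -scalerDr addrACA subrr addr0 half_scaleDD. Qed.

Lemma rpartB_vpart w : rpart w - vpart w = bconj w.
Proof.
by rewrite -scalerBr opprB [w + _]addrC addrACA subrr addr0 half_scaleDD.
Qed.

Lemma bconj_vpart w : bconj (vpart w) = - vpart w.
Proof. by rewrite bconjZ bconjB bconjK -scalerN opprB. Qed.

Lemma vpart_sqr w : vpart w ^+ 2 = - (vpart w * bconj (vpart w)).
Proof. by rewrite bconj_vpart mulrN opprK expr2. Qed.

Lemma vpart_norm_real w :
  bconj (vpart w * bconj (vpart w)) = vpart w * bconj (vpart w).
Proof. by rewrite bconjM bconjK. Qed.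

Lemma powser_real c x : (forall n, `|c n| <= n`!%:R^-1) -> bconj x = x ->
  bconj (powser c x) = powser c x.
Proof. by move=> cle xr; rewrite (bconj_powser x cle) xr. Qed.

Lemma expb_bconj x : bconj (expb x) = expb (bconj x).
Proof. exact: (bconj_powser _ exp_coef_le). Qed.

(** [w] commutes with its conjugate, both being the sum of a central element and
    of a multiple of [vpart w]. *)
Lemma expb_symm w : expb w * bconj (expb w) = expb (2 *: rpart w).
Proof.
rewrite expb_bconj -expbD; last first.
  rewrite -[X in GRing.comm X _]rpartD_vpart -[X in GRing.comm _ X]rpartB_vpart.
  apply: commrB; first exact/commr_sym/bconj_fixed_comm/rpart_real.
  by apply/commr_sym/commrD => //; exact/commr_sym/bconj_fixed_comm/rpart_real.
by rewrite scalerA mulfV ?scale1r ?pnatr_eq0.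
Qed.

Lemma expb_split w : expb w = expb (rpart w) * expb (vpart w).
Proof.
by rewrite -{1}(rpartD_vpart w) expbD //; exact/bconj_fixed_comm/rpart_real.
Qed.

Lemma expb_split_bconj w : expb (bconj w) = expb (rpart w) * expb (- vpart w).
Proof.
by rewrite -(rpartB_vpart w) expbD //; exact/bconj_fixed_comm/rpart_real.
Qed.

Lemma expb_half_sum w : 2^-1 *: (expb w + expb (bconj w))
  = expb (rpart w) * powser cos_coef (vpart w * bconj (vpart w)).
Proof.
rewrite {1}expb_split expb_split_bconj -mulrDr scalerAr.
by rewrite (expb_even_part (vpart_sqr w)).
Qed.

Lemma expb_half_diff w : 2^-1 *: (expb w - expb (bconj w))
  = expb (rpart w) * (powser sin_coef (vpart w * bconj (vpart w)) * vpart w).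
Proof.
rewrite {1}expb_split expb_split_bconj -mulrBr scalerAr.
by rewrite (expb_odd_part (vpart_sqr w)).
Qed.

Lemma expb_mulN (x : biquat R) : expb x * expb (- x) = 1.
Proof. by rewrite -expbD ?subrr ?expb0 //; exact: commrN. Qed.

(** * Slice functions and their stem functions *)

Lemma sphere_coord (I : quat R) : sphere I ->
  q0 I = 0 /\ q1 I ^+ 2 + q2 I ^+ 2 + q3 I ^+ 2 = 1.
Proof.
rewrite /sphere /= expr2 => I2.
have := congr1 (@q0 R) I2; have := congr1 (@q1 R) I2.
have := congr1 (@q2 R) I2; have := congr1 (@q3 R) I2.
rewrite -scaleN1r !quatZE !mkquatE => h3 h2 h1 h0.
(* Otherwise the imaginary coordinates vanish and [I ^+ 2] is positive. *)
have z0 : q0 I = 0.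
  have [//|n0] := eqVneq (q0 I) 0.
  have k (t : R) : q0 I * t = 0 -> t = 0.
    by move/eqP; rewrite mulf_eq0 (negbTE n0) => /eqP.
  have e1 : q1 I = 0 by apply: k; lra.
  have e2 : q2 I = 0 by apply: k; lra.
  have e3 : q3 I = 0 by apply: k; lra.
  by move: h0; rewrite e1 e2 e3; nra.
by split=> //; move: h0; rewrite z0; nra.
Qed.

Lemma sphereN (I : quat R) : sphere I -> sphere (- I).
Proof. by rewrite /sphere /= sqrrN. Qed.

Lemma conjC_ReIm (z : R[i]) :
  (complex.Re z^* = complex.Re z) *
  (complex.Im z^* = - complex.Im z).
Proof. by case: z. Qed.

Lemma complex_eq (z w : R[i]) :
  complex.Re z = complex.Re w -> complex.Im z = complex.Im w -> z = w.
Proof. by case: z w => a b [c d] /= -> ->. Qed.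

(** Two slices meet only along the real axis, unless they coincide, which happens
    exactly for [J = I] and [J = - I]. *)
Lemma point_inj (z w : R[i]) (I J : quat R) : sphere I -> sphere J ->
  Defs.point z I = Defs.point w J ->
  [\/ z = w /\ I = J, w = z^* /\ J = - I | z = w /\ z^* = z].
Proof.
move=> hI hJ; have [I0 I1] := sphere_coord hI; have [J0 J1] := sphere_coord hJ.
move=> e.
have := congr1 (@q0 R) e; have := congr1 (@q1 R) e.
have := congr1 (@q2 R) e; have := congr1 (@q3 R) e.
rewrite /Defs.point !quatDE !quatZE !mkquatE I0 J0 !mulr0 !mulr1 !addr0 !add0r.
move=> e3 e2 e1 e0.
(* [I] and [J] have unit norm, so the imaginary parts agree up to sign. *)
have im2 : complex.Im z ^+ 2 = complex.Im w ^+ 2.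
  rewrite -[LHS]mulr1 -[RHS]mulr1 -{1}I1 -J1 !mulrDr -!exprMn.
  by rewrite e1 e2 e3.
have canc (k a b : R) : k != 0 -> k * a = k * b -> a = b.
  by move=> k0; apply: mulfI.
have [iz0|iz0] := eqVneq (complex.Im z) 0.
  have iw0 : complex.Im w = 0.
    by apply/eqP; rewrite -sqrf_eq0 -im2 iz0 expr0n.
  constructor 3; split; first by apply: complex_eq; rewrite ?iz0 ?iw0.
  by apply: complex_eq; rewrite conjC_ReIm // iz0 oppr0.
move/eqP: im2; rewrite eqf_sqr => /orP[/eqP im|/eqP im].
  constructor 1; split; first exact: complex_eq.
  rewrite -im in e1 e2 e3.
  apply: quatP; first by rewrite I0 J0.
  - exact: canc e1.
  - exact: canc e2.
  - exact: canc e3.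
constructor 2; split; first by apply: complex_eq; rewrite conjC_ReIm ?im ?opprK.
have imw : complex.Im w = - complex.Im z by rewrite im opprK.
rewrite imw in e1 e2 e3.
apply: quatP; rewrite -scaleN1r quatZE; [rewrite I0 J0; lra | ..];
  apply: (canc _ _ _ iz0); lra.
Qed.

Lemma mul_sphereI (I p q : quat R) : sphere I -> I * p = I * q -> p = q.
Proof.
rewrite /sphere /= expr2 => I2 /(congr1 ( *%R I)).
by rewrite !mulrA I2 !mulN1r => /oppr_inj.
Qed.

Lemma sphere_unit : sphere (mkquat 0 1 0 0 : quat R).
Proof.
rewrite /sphere /= expr2 -scaleN1r.
by apply: quatP; rewrite !quatZE !mkquatE; ring.
Qed.

Section Slices.
Variables (D : set R[i]) (cD : conj_invariant D).
Implicit Types (F G : R[i] -> biquat R) (f g : quat R -> quat R).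

(** By [point_inj] two descriptions of a non-real point are equal or related by
    conjugation, and then the stem condition makes the two values agree.  A real
    point lies on every slice, but there the stem condition makes the second
    component vanish. *)
Lemma induces_slice F : stem D F -> induces D F (slice D F).
Proof.
move=> sF; apply: getPex.
exists (fun q => get [set v | exists z I,
  [/\ D z, sphere I, q = Defs.point z I & v = ev I (F z)]]).
move=> z I Dz hI /=.
have := @getPex _ [set v | exists w J,
  [/\ D w, sphere J, Defs.point z I = Defs.point w J & v = ev J (F w)]].
case; first by exists (ev I (F z)), z, I.
move=> w [J [Dw hJ /(point_inj hI hJ) h]] ->.
case: h => [[-> ->]//|[-> ->]|[<- zr]].
  by rewrite sF // /ev /conjHC /= mulrNN.
have : (F z).2 = 0.
  have := sF _ Dz; rewrite zr => /(congr1 snd) /= h.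
  by rewrite -[LHS]half_scaleDD {1}h addNr scaler0.
by rewrite /ev => ->; rewrite !mulr0.
Qed.

(** The values at the points of the slices of [I] and of [- I] determine the two
    components of the stem function. *)
Lemma induces_uniq F G f : induces D F f -> induces D G f ->
  forall z, D z -> F z = G z.
Proof.
move=> hF hG z Dz; have hI := sphere_unit; set I := mkquat 0 1 0 0 in hI.
have e1 := hF _ _ Dz hI; rewrite hG // in e1.
have e2 := hF _ _ Dz (sphereN hI); rewrite (hG _ _ Dz (sphereN hI)) in e2.
(* Adding the two equations eliminates the second components. *)
have h1 : (F z).1 = (G z).1.
  rewrite -[LHS]half_scaleDD -[RHS]half_scaleDD; congr (_ *: _).
  have : (G z).1 + I * (G z).2 + ((G z).1 + - I * (G z).2) =
         (F z).1 + I * (F z).2 + ((F z).1 + - I * (F z).2) by rewrite e1 e2.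
  by rewrite !mulNr !addrA -!(addrAC _ (_ .1)) !addrK.
move: e1; rewrite h1 => /addrI /(mul_sphereI hI) h2.
by rewrite [LHS]surjective_pairing h1 -h2 -surjective_pairing.
Qed.

Definition has_stem F f := stem D F /\ induces D F f.

Lemma has_stem_ev F f : has_stem F f ->
  forall z I, D z -> sphere I -> f (Defs.point z I) = ev I (F z).
Proof. by case. Qed.

Lemma stem_ofE F f : has_stem F f -> forall z, D z -> stem_of D f z = F z.
Proof.
move=> rF; have [_ iS] : has_stem (stem_of D f) f.
  by apply: (@getPex _ [set F | has_stem F f]); exists F.
exact: induces_uniq iS (proj2 rF).
Qed.

(** [stem_of] recovers a stem function on [D] only, hence the hypothesis that the
    two families of values agree there; invariance of [D] carries the stem
    condition from one to the other. *)
Lemma has_stem_slice F G : stem D F -> (forall z, D z -> G z = F z) ->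
  has_stem F (slice D G).
Proof.
move=> sF GF; have sG : stem D G by move=> z Dz; rewrite !GF ?sF //; exact: cD.
by split=> // z I Dz hI; rewrite (induces_slice sG) // GF.
Qed.

Lemma has_stem_star F G f g : has_stem F f -> has_stem G g ->
  has_stem (fun z => F z * G z) (star D f g).
Proof.
move=> rF rG; apply: has_stem_slice => [z Dz|z Dz]; last first.
  by rewrite (stem_ofE rF) // (stem_ofE rG).
by rewrite (proj1 rF) // (proj1 rG) //; exact/esym/iconjM.
Qed.

Lemma bconj_iconj x : bconj (iconj x) = iconj (bconj x) :> biquat R.
Proof.
by congr pair; rewrite /= -[X in conjq X]scaleN1r conjqZ scaleN1r.
Qed.

Lemma has_stem_sconj F f : has_stem F f ->
  has_stem (fun z => bconj (F z)) (sconj D f).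
Proof.
move=> rF; apply: has_stem_slice => [z Dz|z Dz]; last by rewrite (stem_ofE rF).
by rewrite (proj1 rF) //; exact: bconj_iconj.
Qed.

Lemma has_stem_symm F f : has_stem F f ->
  has_stem (fun z => F z * bconj (F z)) (symm D f).
Proof. by move=> rF; exact: has_stem_star rF (has_stem_sconj rF). Qed.

Lemma has_stem_scale F f k : has_stem F f ->
  has_stem (fun z => k *: F z) (fun q => k *: f q).
Proof.
move=> [sF iF]; split=> [z Dz|z I Dz hI]; last by rewrite iF //; exact/esym/evZ.
by rewrite sF //; exact/esym/iconjZ.
Qed.

Lemma has_stem_add F G f g : has_stem F f -> has_stem G g ->
  has_stem (fun z => F z + G z) (fun q => f q + g q).
Proof.
move=> [sF iF] [sG iG]; split=> [z Dz|z I Dz hI].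
  by rewrite sF // sG // /conjHC /= opprD.
by rewrite iF // iG //; exact/esym/evD.
Qed.

Lemma has_stem_opp F f : has_stem F f ->
  has_stem (fun z => - F z) (fun q => - f q).
Proof.
move=> rF; have := has_stem_scale (-1) rF; congr has_stem; apply/funext => z;
  by rewrite scaleN1r.
Qed.

Lemma has_stem_repart F f : has_stem F f ->
  has_stem (fun z => rpart (F z)) (repart D f).
Proof. by move=> rF; apply/has_stem_scale/has_stem_add/has_stem_sconj. Qed.

Lemma has_stem_vecpart F f : has_stem F f ->
  has_stem (fun z => vpart (F z)) (vecpart D f).
Proof.
by move=> rF; apply/has_stem_scale/has_stem_add/has_stem_opp/has_stem_sconj.
Qed.

Lemma has_stem_one : has_stem (fun=> 1) (fun=> 1).
Proof.
by split=> [z _|z I _ _]; [rewrite /conjHC /= oppr0 | exact/esym/ev1].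
Qed.

Lemma has_stem_starX F f n : has_stem F f ->
  has_stem (fun z => F z ^+ n) (starX D f n).
Proof.
move=> rF; elim: n => [|n IH]; first exact: has_stem_one.
have := has_stem_star rF IH; congr has_stem.
by apply/funext => z; rewrite exprS.
Qed.

Lemma lim_quat (u : nat -> quat R) (l : quat R) :
  u n @[n --> \oo] --> l -> limn u = l.
Proof. by apply: cvg_lim; exact: norm_hausdorff. Qed.

Lemma has_stem_expstar F f : has_stem F f ->
  has_stem (fun z => expb (F z)) (expstar D f).
Proof.
move=> rF; split=> [z Dz|z I Dz hI].
  by rewrite (proj1 rF) //; exact/esym/(iconj_powser _ exp_coef_le).
rewrite -[RHS]/(ev I _) /expstar.
rewrite (_ : (fun n => _) = fun n => n`!%:R^-1 *: ev I (F z ^+ n)).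
  by apply: lim_quat; exact: (ev_powser exp_coef_le).
by apply/funext => n; rewrite (has_stem_ev (has_stem_starX n rF) Dz hI).
Qed.

(** The common form of [mu] and [nu].  The powers of [f_v^s] are pointwise, and
    they are the evaluations of the powers of the stem value because the latter
    is fixed by conjugation. *)
Lemma lim_symm_vecpart F f c z I : has_stem F f -> D z -> sphere I ->
  (forall n, `|c n| <= n`!%:R^-1) ->
  limn (series (fun m => c m *: symm D (vecpart D f) (Defs.point z I) ^+ m))
  = ev I (powser c (vpart (F z) * bconj (vpart (F z)))).
Proof.
move=> rF Dz hI cle.
rewrite (_ : (fun m => _) =
  fun m => c m *: ev I ((vpart (F z) * bconj (vpart (F z))) ^+ m)).
  by apply: lim_quat; exact: (ev_powser cle).
apply/funext => m.
rewrite (has_stem_ev (has_stem_symm (has_stem_vecpart rF)) Dz hI).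
by rewrite -evX_real // vpart_norm_real.
Qed.

End Slices.

End Biquaternions.

Theorem proposition4p13 (R : realType) (D : set R[i])
    (hne : circularization D !=set0) (hD : circular_domain D)
    (f : quat R -> quat R) (hf : slice_regular D f) :
  [/\ forall q, circularization D q ->
        symm D (expstar D f) q = expstar D (fun p => 2 * repart D f p) q,
      forall q, circularization D q ->
        2^-1 *: (expstar D f q + expstar D (sconj D f) q)
        = expstar D (repart D f) q * mu D f q,
      forall q, circularization D q ->
        2^-1 *: (expstar D f q - expstar D (sconj D f) q)
        = expstar D (repart D f) q * nu D f q * vecpart D f q,
      forall q, circularization D q ->
        star D (expstar D f) (expstar D (fun p => - f p)) q = 1
    & forall q, circularization D q -> expstar D f q != 0].
Proof.
have [cD _ _] := hD; have [F [sF _ iF]] := hf.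
have rF : has_stem D F f by [].
have rE := has_stem_expstar cD rF.
have rEc := has_stem_expstar cD (has_stem_sconj cD rF).
have rE0 := has_stem_expstar cD (has_stem_repart cD rF).
have rEN := has_stem_expstar cD (has_stem_opp rF).
have E0r z : bconj (expb (rpart (F z))) = expb (rpart (F z)).
  by rewrite expb_bconj rpart_real.
have csr z : bconj (powser (@sin_coef R) (vpart (F z) * bconj (vpart (F z)))) =
    powser (@sin_coef R) (vpart (F z) * bconj (vpart (F z))).
  by apply: powser_real; [exact: sin_coef_le | exact: vpart_norm_real].
split=> q [z [I [Dz hI ->]]].
- rewrite (has_stem_ev (has_stem_symm cD rE) Dz hI) expb_symm.
  have -> : (fun p => 2 * repart D f p) = fun p => (2 : R) *: repart D f p.
    apply/funext => p.
    by rewrite -[in RHS](mul1r (repart D f p)) scalerAl scaler_nat.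
  have r2 := has_stem_scale 2 (has_stem_repart cD rF).
  by rewrite (has_stem_ev (has_stem_expstar cD r2) Dz hI).
- rewrite (has_stem_ev rE Dz hI) (has_stem_ev rEc Dz hI) (has_stem_ev rE0 Dz hI).
  rewrite /mu (lim_symm_vecpart cD rF Dz hI (@cos_coef_le R)).
  by rewrite -evD -evZ -evM_real // expb_half_sum.
- rewrite (has_stem_ev rE Dz hI) (has_stem_ev rEc Dz hI) (has_stem_ev rE0 Dz hI).
  rewrite (has_stem_ev (has_stem_vecpart cD rF) Dz hI).
  rewrite /nu (lim_symm_vecpart cD rF Dz hI (@sin_coef_le R)).
  by rewrite -evB -evZ expb_half_diff evM_real // evM_real // mulrA.
- rewrite (has_stem_ev (has_stem_star cD rE rEN) Dz hI) expb_mulN; exact: ev1.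
- rewrite (has_stem_ev rE Dz hI); apply/eqP => /(evM_eq0 (expb (- F z)) hI).
  by rewrite expb_mulN ev1 => /eqP; rewrite oner_eq0.
Qed.
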